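(* Let $\alpha,\beta,\gamma,\delta\in\mathbb{R}$ with $\alpha+\delta\neq0$ and $\alpha\gamma=0$, and let $G_7$ be the connected, simply connected three-dimensional Lie group with left-invariant Lorentzian metric $g$ whose Lie algebra has a pseudo-orthonormal basis $\{\widetilde e_1,\widetilde e_2,\widetilde e_3\}$, with $\widetilde e_3$ timelike, satisfying $$[\widetilde e_1,\widetilde e_2]=-\alpha\widetilde e_1-\beta\widetilde e_2-\beta\widetilde e_3,\quad [\widetilde e_1,\widetilde e_3]=\alpha\widetilde e_1+\beta\widetilde e_2+\beta\widetilde e_3,\quad [\widetilde e_2,\widetilde e_3]=\gamma\widetilde e_1+\delta\widetilde e_2+\delta\widetilde e_3.$$ Let $\nabla^B$ be the Bott connection and $\widetilde\rho^B$ its symmetrized Ricci tensor. Then $(G_7,\nabla^B,\widetilde\rho^B)$ is not a quasi-statistical structure.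
   Context: Basis vectors are identified with left-invariant vector fields on the group $G$; $g(\widetilde e_1,\widetilde e_1)=g(\widetilde e_2,\widetilde e_2)=1$, $g(\widetilde e_3,\widetilde e_3)=-1$, and $g(\widetilde e_i,\widetilde e_j)=0$ for $i\ne j$. Let $\nabla^L$ be the Levi-Civita connection of $g$, $D=\mathrm{span}\{\widetilde e_1,\widetilde e_2\}$, $D^\perp=\mathrm{span}\{\widetilde e_3\}$ (distributions on $G$), with associated projections $\pi_D,\pi_{D^\perp}$ of $TG=D\oplus D^\perp$. The Bott connection $\nabla^B$ is the linear connection given by: $\nabla^B_XY=\pi_D(\nabla^L_XY)$ for $X,Y\in\Gamma^\infty(D)$; $\nabla^B_XY=\pi_D([X,Y])$ for $X\in\Gamma^\infty(D^\perp),Y\in\Gamma^\infty(D)$; $\nabla^B_XY=\pi_{D^\perp}([X,Y])$ for $X\in\Gamma^\infty(D),Y\in\Gamma^\infty(D^\perp)$; $\nabla^B_XY=\pi_{D^\perp}(\nabla^L_XY)$ for $X,Y\in\Gamma^\infty(D^\perp)$. Curvature: $R^B(X,Y)Z=\nabla^B_X\nabla^B_YZ-\nabla^B_Y\nabla^B_XZ-\nabla^B_{[X,Y]}Z$. Ricci tensor: $\rho^B(X,Y)=-g(R^B(X,\widetilde e_1)Y,\widetilde e_1)-g(R^B(X,\widetilde e_2)Y,\widetilde e_2)+g(R^B(X,\widetilde e_3)Y,\widetilde e_3)$. Symmetrized Ricci tensor: $\widetilde\rho^B(X,Y)=\tfrac12(\rho^B(X,Y)+\rho^B(Y,X))$.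 For a linear connection $\nabla$ with torsion $T(X,Y)=\nabla_XY-\nabla_YX-[X,Y]$ and a $(0,2)$ tensor field $\omega$, put $(\nabla_X\omega)(Y,Z)=X[\omega(Y,Z)]-\omega(\nabla_XY,Z)-\omega(Y,\nabla_XZ)$. The triple $(G,\nabla,\omega)$ is called a quasi-statistical structure if $(\nabla_X\omega)(Y,Z)-(\nabla_Y\omega)(X,Z)+\omega(T(X,Y),Z)=0$ for all vector fields $X,Y,Z$. *)

(* Defs.v *)
From HB Require Import structures.
From mathcomp Require Import all_boot all_order all_algebra.
From mathcomp Require Import all_classical all_reals all_analysis.

Set Implicit Arguments.
Unset Strict Implicit.
Unset Printing Implicit Defensive.

Import Order.TTheory GRing.Theory Num.Theory.
Import numFieldNormedType.Exports.

Local Open Scope classical_set_scope.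
Local Open Scope ring_scope.

(* C^k and C^oo maps on an open subset U of a (finite-dimensional) space:      *)
(* f is C^(k+1) iff it is Frechet differentiable on U and all the maps         *)
(* x |-> df_x(v) are C^k; for finite-dimensional V this is the usual notion.   *)
Fixpoint Ck_on (R : realType) (V W : normedModType R) (k : nat)
    (U : set V) (f : V -> W) : Prop :=
  if k is k'.+1 then
    (forall x, U x -> differentiable f x) /\
    (forall v, Ck_on k' U (fun x => 'd f x v))
  else forall x, U x -> {for x, continuous f}.

Definition smooth_on (R : realType) (V W : normedModType R)
    (U : set V) (f : V -> W) : Prop :=
  forall k, Ck_on k U f.

(* Smooth n-dimensional manifolds. The smooth structure is given by an atlas   *)
(* indexed by the points, with p in the domain of chart p; every atlas         *)
(* contains charts around every point, so this is no restriction.              *)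
HB.mixin Record Topological_isManifold (R : realType) (n : nat) (M : Type)
    of Topological M := {
  chart_dom : M -> set M ;
  chart : M -> M -> 'rV[R]_n ;
  chart_inv : M -> 'rV[R]_n -> M ;
  manifold_hausdorff : hausdorff_space M ;
  manifold_second_countable : @second_countable M ;
  chart_dom_open : forall p, open (chart_dom p) ;
  chart_dom_center : forall p, chart_dom p p ;
  chart_image_open : forall p, open (chart p @` chart_dom p) ;
  chart_invK : forall p q, chart_dom p q -> chart_inv p (chart p q) = q ;
  chart_continuous :
    forall p q, chart_dom p q -> {for q, continuous (chart p)} ;
  chart_inv_continuous :
    forall p x, (chart p @` chart_dom p) x -> {for x, continuous (chart_inv p)} ;
  chart_transition_smooth :
    forall p q, smooth_on (chart p @` (chart_dom p `&` chart_dom q))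
                          (fun x => chart q (chart_inv p x))
}.

#[short(type="manifoldType")]
HB.structure Definition Manifold (R : realType) (n : nat) :=
  { M of Topological M & Topological_isManifold R n M }.

Section Manifold.
Context {R : realType}.

Definition smooth_map (m n : nat) (M : manifoldType R m) (N : manifoldType R n)
    (f : M -> N) : Prop :=
  continuous f /\
  forall p, exists2 U : set 'rV[R]_m, open U /\ U (chart p p) &
    smooth_on U (fun x => chart (f p) (f (chart_inv p x))).

Context {n : nat} {M : manifoldType R n}.

Definition smooth_fun (f : M -> R) : Prop :=
  forall p, smooth_on (chart p @` chart_dom p) (fun x => f (chart_inv p x)).

(* A tangent vector at p is represented by its coordinates in chart p, so that *)
(* a section of TM, smooth or not, is a map M -> 'rV[R]_n. The coordinates of  *)
(* v : T_q M in chart p are obtained with the differential of the transition   *)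
(* map.                                                                        *)
Definition change_chart (p q : M) (v : 'rV[R]_n) : 'rV[R]_n :=
  'd (fun x => chart p (chart_inv q x)) (chart q q) v.

Definition local_rep (X : M -> 'rV[R]_n) (p : M) (x : 'rV[R]_n) : 'rV[R]_n :=
  let q := chart_inv p x in change_chart p q (X q).

Definition vector_field (X : M -> 'rV[R]_n) : Prop :=
  forall p, smooth_on (chart p @` chart_dom p) (local_rep X p).

(* X[f] *)
Definition lie_deriv (X : M -> 'rV[R]_n) (f : M -> R) : M -> R :=
  fun p => 'd (fun x => f (chart_inv p x)) (chart p p) (X p).

(* In a chart, [X, Y]^k = X^i d_i Y^k - Y^i d_i X^k. *)
Definition lie_bracket (X Y : M -> 'rV[R]_n) : M -> 'rV[R]_n :=
  fun p => 'd (local_rep Y p) (chart p p) (X p)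
         - 'd (local_rep X p) (chart p p) (Y p).

Definition is_connection
    (nabla : (M -> 'rV[R]_n) -> (M -> 'rV[R]_n) -> M -> 'rV[R]_n) : Prop :=
  [/\ forall X Y, vector_field X -> vector_field Y ->
        vector_field (nabla X Y),
      forall X X' Y, vector_field X -> vector_field X' -> vector_field Y ->
        nabla (fun p => X p + X' p) Y = (fun p => nabla X Y p + nabla X' Y p),
      forall f X Y, smooth_fun f -> vector_field X -> vector_field Y ->
        nabla (fun p => f p *: X p) Y = (fun p => f p *: nabla X Y p),
      forall X Y Y', vector_field X -> vector_field Y -> vector_field Y' ->
        nabla X (fun p => Y p + Y' p) = (fun p => nabla X Y p + nabla X Y' p)
    & forall f X Y, smooth_fun f -> vector_field X -> vector_field Y ->
        nabla X (fun p => f p *: Y p) =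
          (fun p => lie_deriv X f p *: Y p + f p *: nabla X Y p)].

Definition torsion
    (nabla : (M -> 'rV[R]_n) -> (M -> 'rV[R]_n) -> M -> 'rV[R]_n)
    (X Y : M -> 'rV[R]_n) : M -> 'rV[R]_n :=
  fun p => nabla X Y p - nabla Y X p - lie_bracket X Y p.

Definition curvature
    (nabla : (M -> 'rV[R]_n) -> (M -> 'rV[R]_n) -> M -> 'rV[R]_n)
    (X Y Z : M -> 'rV[R]_n) : M -> 'rV[R]_n :=
  fun p => nabla X (nabla Y Z) p - nabla Y (nabla X Z) p
         - nabla (lie_bracket X Y) Z p.

(* (nabla_X w)(Y, Z), where w maps two vector fields to a function *)
Definition cov_deriv
    (nabla : (M -> 'rV[R]_n) -> (M -> 'rV[R]_n) -> M -> 'rV[R]_n)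
    (w : (M -> 'rV[R]_n) -> (M -> 'rV[R]_n) -> M -> R)
    (X Y Z : M -> 'rV[R]_n) : M -> R :=
  fun p => lie_deriv X (w Y Z) p - w (nabla X Y) Z p - w Y (nabla X Z) p.

Definition quasi_statistical
    (nabla : (M -> 'rV[R]_n) -> (M -> 'rV[R]_n) -> M -> 'rV[R]_n)
    (w : (M -> 'rV[R]_n) -> (M -> 'rV[R]_n) -> M -> R) : Prop :=
  forall X Y Z, vector_field X -> vector_field Y -> vector_field Z ->
  forall p, cov_deriv nabla w X Y Z p - cov_deriv nabla w Y X Z p
            + w (torsion nabla X Y) Z p = 0.

(* A field of bilinear forms g gives for each p a form on T_p M. *)
Definition on_fields (g : M -> 'rV[R]_n -> 'rV[R]_n -> R)
    (X Y : M -> 'rV[R]_n) : M -> R :=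
  fun p => g p (X p) (Y p).

Definition levi_civita (g : M -> 'rV[R]_n -> 'rV[R]_n -> R)
    (nabla : (M -> 'rV[R]_n) -> (M -> 'rV[R]_n) -> M -> 'rV[R]_n) : Prop :=
  [/\ is_connection nabla,
      forall X Y, vector_field X -> vector_field Y ->
        forall p, torsion nabla X Y p = 0
    & forall X Y Z, vector_field X -> vector_field Y -> vector_field Z ->
        forall p, cov_deriv nabla (on_fields g) X Y Z p = 0].

(* A distribution is a field of subspaces D p of T_p M, given as row spaces. *)
Definition section_of (D : M -> 'M[R]_n) (X : M -> 'rV[R]_n) : Prop :=
  vector_field X /\ forall p, (X p <= D p)%MS.

(* For TM = D (+) D', the projection on D along D' *)
Definition proj (D D' : M -> 'M[R]_n) (X : M -> 'rV[R]_n) : M -> 'rV[R]_n :=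
  fun p => X p *m proj_mx (D p) (D' p).

Definition bott_connection (D D' : M -> 'M[R]_n)
    (nablaL nablaB : (M -> 'rV[R]_n) -> (M -> 'rV[R]_n) -> M -> 'rV[R]_n)
    : Prop :=
  [/\ is_connection nablaB,
      forall X Y, section_of D X -> section_of D Y ->
        nablaB X Y = proj D D' (nablaL X Y),
      forall X Y, section_of D' X -> section_of D Y ->
        nablaB X Y = proj D D' (lie_bracket X Y),
      forall X Y, section_of D X -> section_of D' Y ->
        nablaB X Y = proj D' D (lie_bracket X Y)
    & forall X Y, section_of D' X -> section_of D' Y ->
        nablaB X Y = proj D' D (nablaL X Y)].

End Manifold.

(* Three-dimensional Lorentzian geometry, signature (+, +, -) *)
Section Lorentz3.
Context {R : realType} {M : manifoldType R 3}.

Definition pseudo_orthonormal_at (b : 'rV[R]_3 -> 'rV[R]_3 -> R)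
    (v1 v2 v3 : 'rV[R]_3) : Prop :=
  [/\ b v1 v1 = 1, b v2 v2 = 1 & b v3 v3 = -1] /\
  [/\ b v1 v2 = 0, b v1 v3 = 0 & b v2 v3 = 0].

Definition lorentzian_metric (g : M -> 'rV[R]_3 -> 'rV[R]_3 -> R) : Prop :=
  [/\ forall p u v, g p u v = g p v u,
      forall p u, scalar (g p u),
      forall p, exists v1 v2 v3, pseudo_orthonormal_at (g p) v1 v2 v3
    & forall X Y, vector_field X -> vector_field Y ->
        smooth_fun (on_fields g X Y)].

Definition pseudo_orthonormal (g : M -> 'rV[R]_3 -> 'rV[R]_3 -> R)
    (e1 e2 e3 : M -> 'rV[R]_3) : Prop :=
  forall p, pseudo_orthonormal_at (g p) (e1 p) (e2 p) (e3 p).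

Definition ricci (g : M -> 'rV[R]_3 -> 'rV[R]_3 -> R)
    (e1 e2 e3 : M -> 'rV[R]_3)
    (nabla : (M -> 'rV[R]_3) -> (M -> 'rV[R]_3) -> M -> 'rV[R]_3)
    (X Y : M -> 'rV[R]_3) : M -> R :=
  fun p => - g p (curvature nabla X e1 Y p) (e1 p)
           - g p (curvature nabla X e2 Y p) (e2 p)
           + g p (curvature nabla X e3 Y p) (e3 p).

Definition sym_ricci (g : M -> 'rV[R]_3 -> 'rV[R]_3 -> R)
    (e1 e2 e3 : M -> 'rV[R]_3)
    (nabla : (M -> 'rV[R]_3) -> (M -> 'rV[R]_3) -> M -> 'rV[R]_3)
    (X Y : M -> 'rV[R]_3) : M -> R :=
  fun p => 2^-1 * (ricci g e1 e2 e3 nabla X Y p + ricci g e1 e2 e3 nabla Y X p).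

Definition span1 (e : M -> 'rV[R]_3) : M -> 'M[R]_3 := fun p => <<e p>>%MS.

Definition span2 (e e' : M -> 'rV[R]_3) : M -> 'M[R]_3 :=
  fun p => (e p + e' p)%MS.

End Lorentz3.

HB.mixin Record Manifold_isLieGroup (R : realType) (n : nat) (G : Type)
    of Manifold R n G & Group G := {
  mulg_continuous : continuous (fun z : G * G => (z.1 * z.2)%g) ;
  (* smoothness of G * G -> G around (a, b), in the charts at a, b and ab *)
  mulg_smooth : forall a b : G,
    exists2 U : set ('rV[R]_n * 'rV[R]_n)%type,
      open U /\ U (chart a a, chart b b) &
      smooth_on U
        (fun z => chart (a * b)%g (chart_inv a z.1 * chart_inv b z.2)%g) ;
  invg_smooth : smooth_map (fun a : G => a^-1%g)
}.

#[short(type="lieGroupType")]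
HB.structure Definition LieGroup (R : realType) (n : nat) :=
  { G of Manifold R n G & Group G & Manifold_isLieGroup R n G }.

Section LeftInvariance.
Context {R : realType}.

(* The differential at p of the left translation by a *)
Definition left_translation_diff (n : nat) (G : lieGroupType R n) (a p : G)
    (v : 'rV[R]_n) : 'rV[R]_n :=
  'd (fun x => chart (a * p)%g (a * chart_inv p x)%g) (chart p p) v.

Definition left_invariant_field (n : nat) (G : lieGroupType R n)
    (X : G -> 'rV[R]_n) : Prop :=
  vector_field X /\
  forall a p, left_translation_diff a p (X p) = X (a * p)%g.

Definition left_invariant_metric (n : nat) (G : lieGroupType R n)
    (g : G -> 'rV[R]_n -> 'rV[R]_n -> R) : Prop :=
  forall a p u v,
    g (a * p)%g (left_translation_diff a p u) (left_translation_diff a p v)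
    = g p u v.

(* e1, e2, e3 form a basis of the Lie algebra of left-invariant fields. *)
Definition lie_algebra_basis (G : lieGroupType R 3)
    (e1 e2 e3 : G -> 'rV[R]_3) : Prop :=
  [/\ left_invariant_field e1, left_invariant_field e2,
      left_invariant_field e3
    & forall X, left_invariant_field X ->
        exists! c : R * R * R,
          forall p, X p = c.1.1 *: e1 p + c.1.2 *: e2 p + c.2 *: e3 p].

End LeftInvariance.

(* Path-connected, and every loop is homotopic to a constant loop through      *)
(* loops with the same base point.                                             *)
Definition simply_connected (R : realType) (T : topologicalType) : Prop :=
  (forall x y : T, exists c : R -> T,
     [/\ {within `[0, 1], continuous c}, c 0 = x & c 1 = y]) /\
  (forall c : R -> T, {within `[0, 1], continuous c} -> c 0 = c 1 ->
     exists H : R * R -> T,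
       [/\ {within `[0, 1] `*` `[0, 1], continuous H},
           forall t, t \in `[0, 1] -> H (t, 0) = c t,
           forall t, t \in `[0, 1] -> H (t, 1) = c 0
         & forall s, s \in `[0, 1] -> H (0, s) = c 0 /\ H (1, s) = c 0]).

(* Main.v *)
Require Import Defs.
From HB Require Import structures.
From mathcomp Require Import all_boot all_order all_algebra.
From mathcomp Require Import all_classical all_reals all_analysis.
From mathcomp Require Import ring lra.

Import Order.TTheory GRing.Theory Num.Theory.
Import numFieldNormedType.Exports.

Local Open Scope classical_set_scope.
Local Open Scope ring_scope.

(** In the frame e1, e2, e3 the brackets and the metric have constant
    coefficients, so the whole statement is a computation with constants.
    Vector fields which are constant combinations of the frame ([frame_comb])
    are closed under the Lie bracket, under the Bott connection
    ([bott_frame_comb]) and hence under curvature and torsion; on them the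
    symmetrized Ricci tensor is a constant bilinear form
    ([sym_ricci_frame_comb]), so that the term X[w(Y, Z)] in its covariant
    derivative vanishes.  The Levi-Civita part of the Bott connection is read
    off from Koszul's formula, which for constant inner products involves
    brackets only ([koszul_constant]).

    The quasi-statistical condition therefore becomes polynomial equations in
    alpha, beta, gamma, delta.  Three of them are contradictory when
    alpha + delta != 0.  The triple (e1, e2, e3) gives
    beta (alpha + delta)^2 = 0, so beta = 0.  Once beta = 0, the triples
    (e1, e3, e1) and (e2, e3, e3) give
    alpha (2 alpha^2 - alpha delta / 2 - delta^2) = 0 and
    delta^2 (alpha + 2 delta) = 0.  If delta != 0 then alpha = - 2 delta and
    the first of these reads - 16 delta^3 = 0; hence delta = 0, and then
    2 alpha^3 = 0.

    The computation evaluates fields by using real-linearity of the bracket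
    and of a connection, which presuppose smooth fields.  This is why smooth maps
    and smooth vector fields have to be shown stable under linear combinations. *)

Set Implicit Arguments.
Unset Strict Implicit.
Unset Printing Implicit Defensive.

(** * Smooth maps on an open set *)

Section SmoothMaps.
Variables (R : realType) (V W : normedModType R).
Implicit Types (U : set V) (f g h : V -> W).

(** Differentiability at x depends on the germ at x only. *)
Lemma differentiable_near_eq f g (x : V) :
    (\forall y \near x, g y = f y) -> differentiable f x ->
  differentiable g x /\ 'd g x = 'd f x :> (V -> W).
Proof.
move=> fg df; have fgx : g x = f x by exact: nbhs_singleton fg.
have gE : g \o shift x = cst (g x) + 'd f x +o_ 0 id.
  apply/eqaddoP => eps eps0.
  have /eqaddoP/(_ _ eps0) := diff_locally df.
  have : \forall h \near (0 : V), (g \o shift x) h = (f \o shift x) h.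
    by move: fg; rewrite (near_shift 0) subr0.
  apply: filterS2 => h /= gfh.
  by rewrite -![(_ + _ : V -> W) _]/(_ + _) -![(- _ : V -> W) _]/(- _) /cst /=
    fgx -gfh.
have dE : 'd g x = 'd f x :> (V -> W).
  by apply: diff_unique gE; exact: diff_continuous.
by split=> //; apply/diff_locallyP; rewrite dE; split=> //; exact: diff_continuous.
Qed.

(** The differential of f at a point of U is determined by f on U because U is
    open; so the induction on k passes from f and g to their differentials. *)
Lemma Ck_on_eq k U f g :
  open U -> (forall x, U x -> g x = f x) -> Ck_on k U f -> Ck_on k U g.
Proof.
move=> oU; elim: k f g => [|k IH] f g fg /=.
  move=> cf x Ux; have cfx : f @ x --> f x by exact: cf.
  rewrite -(fg _ Ux) in cfx; apply: cvg_trans cfx; apply: near_eq_cvg.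
  by apply: filterS (open_nbhs_nbhs (conj oU Ux)) => y Uy; rewrite fg.
move=> [df Cdf].
have E x : U x -> differentiable g x /\ 'd g x = 'd f x :> (V -> W).
  move=> Ux; apply: differentiable_near_eq; last exact: df.
  exact: filterS fg (open_nbhs_nbhs (conj oU Ux)).
split=> [x /E[]//|v]; apply: IH (Cdf v) => x Ux.
by rewrite (E x Ux).2.
Qed.

Lemma Ck_on_cst k U (c : W) : Ck_on k U (cst c).
Proof.
elim: k c => [|k IH] c /=; first by move=> x _; exact: cst_continuous.
split=> [x _|v]; first exact: differentiable_cst.
by under eq_fun do rewrite diff_cst; exact: IH.
Qed.

Lemma diff_scaleD (c : R) f g (x v : V) :
  differentiable f x -> differentiable g x ->
  'd (fun y => c *: f y + g y) x v = c *: 'd f x v + 'd g x v.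
Proof.
move=> df dg; have dcf := differentiableZ c df.
by rewrite -[fun y => _]/(c *: f + g) (diffD dcf dg) (diffZ c df).
Qed.

(** The differential of a linear combination is the combination of the
    differentials on U only: outside U it is an arbitrary linear map.  The
    induction therefore goes through [Ck_on_eq]. *)
Lemma Ck_on_lin k U (c : R) f g :
  open U -> Ck_on k U f -> Ck_on k U g -> Ck_on k U (fun x => c *: f x + g x).
Proof.
move=> oU; rewrite -[fun x => _]/(c *: f + g).
elim: k f g => [|k IH] f g /=.
  move=> cf cg x Ux; apply: continuousD (cg x Ux).
  exact: cvgZr (cf x Ux).
move=> [df Cdf] [dg Cdg]; split=> [x Ux|v].
  exact: differentiableD (differentiableZ c (df x Ux)) (dg x Ux).
apply: Ck_on_eq (IH _ _ (Cdf v) (Cdg v)) => // x Ux.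
by rewrite diff_scaleD; [| exact: df | exact: dg].
Qed.

End SmoothMaps.

(** * Vector fields and connections *)

Section Fields.
Variables (R : realType) (n : nat) (M : manifoldType R n).
Implicit Types (X Y Z : M -> 'rV[R]_n).

Lemma smooth_fun_cst (c : R) : smooth_fun (fun _ : M => c).
Proof. by move=> p k; exact: Ck_on_cst. Qed.

Lemma lie_deriv_cst X (c : R) p : lie_deriv X (fun _ => c) p = 0.
Proof. by rewrite /lie_deriv (diff_cst c). Qed.

Lemma local_rep_lin (c : R) X Y q :
  local_rep (fun p => c *: X p + Y p) q =
  fun x => c *: local_rep X q x + local_rep Y q x.
Proof. by apply/funext => x; rewrite /local_rep /change_chart linearP. Qed.

Lemma vector_field_lin (c : R) X Y :
  vector_field X -> vector_field Y -> vector_field (fun p => c *: X p + Y p).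
Proof.
move=> sX sY p k; rewrite local_rep_lin.
exact: Ck_on_lin (chart_image_open p) (sX p k) (sY p k).
Qed.

Lemma vector_field0 : vector_field (fun _ : M => 0 : 'rV[R]_n).
Proof.
move=> p k; rewrite (_ : local_rep _ p = cst 0); first exact: Ck_on_cst.
by apply/funext => x; rewrite /local_rep /change_chart linear0.
Qed.

(** Linearity over the reals, not over functions: neither a connection nor the
    Lie bracket is linear over functions in both arguments. *)
Definition field_linear (F : (M -> 'rV[R]_n) -> M -> 'rV[R]_n) : Prop :=
  forall (c : R) X Y, vector_field X -> vector_field Y ->
    F (fun p => c *: X p + Y p) = fun p => c *: F X p + F Y p.

Definition field_bilinear
    (op : (M -> 'rV[R]_n) -> (M -> 'rV[R]_n) -> M -> 'rV[R]_n) : Prop :=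
  forall Z, vector_field Z -> field_linear (op ^~ Z) /\ field_linear (op Z).

Lemma lie_bracketC X Y p : lie_bracket Y X p = - lie_bracket X Y p.
Proof. by rewrite /lie_bracket opprB. Qed.

(** In the chart at p the bracket is d Y (X) - d X (Y): the first term is linear
    in Y because differentiation is, the second because a differential is a
    linear map.  Linearity in X follows by antisymmetry. *)
Lemma lie_bracket_bilinear : field_bilinear lie_bracket.
Proof.
have linr Z : vector_field Z -> field_linear (lie_bracket Z).
  move=> sZ c X Y sX sY; apply/funext => p.
  have dX V : vector_field V -> differentiable (local_rep V p) (chart p p).
    move=> sV; have [dV _] := sV p 1%N.
    by apply: dV; exists p => //; exact: chart_dom_center.
  rewrite /lie_bracket local_rep_lin; move: (dX _ sX) (dX _ sY).
  move: (local_rep X p) (local_rep Y p) (local_rep Z p) => f h k df dh.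
  apply: (etrans (congr2 (fun u v => u - v) (diff_scaleD _ _ df dh)
                                            (linearP _ _ _ _))).
  have sub_lin (a a' b b' : 'rV[R]_n) :
      c *: a + a' - (c *: b + b') = c *: (a - b) + (a' - b').
    by rewrite scalerBr opprD addrACA.
  exact: sub_lin.
move=> Z sZ; split; last exact: linr.
move=> c X Y sX sY; apply/funext => p.
by rewrite ![lie_bracket _ Z p]lie_bracketC linr // opprD scalerN.
Qed.

Variable nabla : (M -> 'rV[R]_n) -> (M -> 'rV[R]_n) -> M -> 'rV[R]_n.

(** In the second argument this is the Leibniz rule for a constant function,
    whose derivative term vanishes. *)
Lemma connection_bilinear : is_connection nabla -> field_bilinear nabla.
Proof.
move=> [_ addl scalel addr scaler] Z sZ.
have sc (c : R) X : vector_field X -> vector_field (fun p => c *: X p).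
  move=> sX; rewrite (_ : (fun p => _) = fun p => c *: X p + 0).
    exact: vector_field_lin sX vector_field0.
  by apply/funext => p; rewrite addr0.
split=> c X Y sX sY /=.
  by rewrite addl ?scalel //; [exact: smooth_fun_cst | exact: sc].
rewrite addr ?scaler //; [|exact: smooth_fun_cst|exact: sc].
by apply/funext => p; rewrite lie_deriv_cst scale0r add0r.
Qed.

End Fields.

(** * Constant combinations of three fields *)

Section Frame.
Variables (R : realType) (n : nat) (M : manifoldType R n).
Variables (e1 e2 e3 : M -> 'rV[R]_n).
Hypotheses (s1 : vector_field e1) (s2 : vector_field e2) (s3 : vector_field e3).

Definition frame_comb (x y z : R) : M -> 'rV[R]_n :=
  fun p => x *: e1 p + y *: e2 p + z *: e3 p.

(** The nested form, ending in the zero field, is the one on which linearity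
    can be used step by step. *)
Lemma frame_combE x y z : frame_comb x y z =
  fun p => x *: e1 p + (fun p => y *: e2 p + (fun p => z *: e3 p + 0) p) p.
Proof. by apply/funext => p; rewrite addr0 addrA. Qed.

Lemma vector_field_frame_comb x y z : vector_field (frame_comb x y z).
Proof.
by rewrite frame_combE; do 3!apply: vector_field_lin => //; exact: vector_field0.
Qed.

Lemma field_linear_frame_comb F x y z : field_linear F ->
  F (frame_comb x y z) = fun p => x *: F e1 p + y *: F e2 p + z *: F e3 p.
Proof.
move=> linF; have s0 := @vector_field0 _ _ M.
have F0 : F (fun _ => 0) = fun _ => 0.
  have := linF (-1) _ _ s0 s0; rewrite scaler0 addr0 => ->.
  by apply/funext => p; rewrite scaleN1r addNr.
rewrite frame_combE !linF ?F0//; try by do ?apply: vector_field_lin.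
by apply/funext => p; rewrite addr0 addrA.
Qed.

Lemma field_bilinear_frame_comb op x1 x2 x3 y1 y2 y3 : field_bilinear op ->
  op (frame_comb x1 x2 x3) (frame_comb y1 y2 y3) = fun p =>
    x1 *: (y1 *: op e1 e1 p + y2 *: op e1 e2 p + y3 *: op e1 e3 p) +
    x2 *: (y1 *: op e2 e1 p + y2 *: op e2 e2 p + y3 *: op e2 e3 p) +
    x3 *: (y1 *: op e3 e1 p + y2 *: op e3 e2 p + y3 *: op e3 e3 p).
Proof.
move=> bil; have [linl _] := bil _ (vector_field_frame_comb y1 y2 y3).
rewrite (field_linear_frame_comb _ _ _ linl); apply/funext => p /=.
by rewrite !(field_linear_frame_comb _ _ _ (bil _ _).2).
Qed.

End Frame.

(** * Pseudo-orthonormal triples *)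

Lemma form_subl (R : realType) (n : nat) (b : 'rV[R]_n -> 'rV[R]_n -> R) :
    (forall u v, b u v = b v u) -> (forall u, scalar (b u)) ->
  forall u v w, b (u - v) w = b u w - b v w.
Proof.
move=> bC blin u v w; have := blin w (-1) v u.
by rewrite scaleN1r mulN1r ![b w _]bC => e; rewrite addrC e addrC.
Qed.

Section PseudoOrthonormal.
Variables (R : realType) (b : 'rV[R]_3 -> 'rV[R]_3 -> R) (v1 v2 v3 : 'rV[R]_3).
Hypotheses (bC : forall u v, b u v = b v u) (blin : forall u, scalar (b u)).
Hypothesis ortho : pseudo_orthonormal_at b v1 v2 v3.

Lemma form_comb x y z w :
  b (x *: v1 + y *: v2 + z *: v3) w = x * b v1 w + y * b v2 w + z * b v3 w.
Proof.
have b0 u : b u 0 = 0.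
  by have := blin u (-1) 0 0; rewrite scaler0 addr0 mulN1r addNr.
have bZ u k v : b u (k *: v) = k * b u v.
  by have := blin u k v 0; rewrite addr0 b0 addr0.
rewrite -addrA bC blin -[y *: v2 + _]addr0 -addrA blin addr0 bZ.
by rewrite !(bC w) addrA.
Qed.

Lemma form_comb_coord x y z (v := x *: v1 + y *: v2 + z *: v3) :
  [/\ b v v1 = x, b v v2 = y & b v v3 = - z].
Proof.
have [[b11 b22 b33] [b12 b13 b23]] := ortho.
have [b21 b31 b32] : [/\ b v2 v1 = 0, b v3 v1 = 0 & b v3 v2 = 0].
  by rewrite ![b v3 _]bC [b v2 v1]bC.
by rewrite /v !form_comb b11 b12 b13 b21 b22 b23 b31 b32 b33; split; ring.
Qed.

(** The inner products recover the coefficients of a combination of the three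
    vectors, so these are linearly independent and, in dimension 3, span. *)
Lemma pseudo_orthonormal_expand v :
  v = b v v1 *: v1 + b v v2 *: v2 - b v v3 *: v3.
Proof.
pose A : 'M[R]_3 := \matrix_(i < 3) [:: v1; v2; v3]`_i.
have mulA (u : 'rV[R]_3) : u *m A =
    u 0 0 *: v1 + u 0 (lift 0 0) *: v2 + u 0 (lift 0 (lift 0 0)) *: v3.
  by rewrite mulmx_sum_row !big_ord_recl big_ord0 !rowK /= addr0 addrA.
have Afull : row_full A.
  rewrite row_full_unit -row_free_unit; apply: inj_row_free => u.
  rewrite mulA => u0.
  have [] := form_comb_coord (u 0 0) (u 0 (lift 0 0)) (u 0 (lift 0 (lift 0 0))).
  rewrite u0; have b0 w : b 0 w = 0.
    by have := form_comb 0 0 0 w; rewrite !scale0r !addr0 !mul0r !addr0.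
  rewrite !b0 => e0 e1 /esym/eqP; rewrite oppr_eq0 => /eqP e2.
  apply/rowP => i; rewrite mxE.
  by case: (unliftP 0 i) => [j|] ->; rewrite -?e0 //;
    case: (unliftP 0 j) => [k|] ->; rewrite -?e1 // (ord1 k) e2.
have /submxP[w ->] := submx_full v Afull.
rewrite mulA.
have [-> -> ->] :=
  form_comb_coord (w 0 0) (w 0 (lift 0 0)) (w 0 (lift 0 (lift 0 0))).
by rewrite scaleNr opprK.
Qed.

(** A vector in both spaces has zero inner product with v3 as a combination of
    v1 and v2, hence zero coefficient as a multiple of v3. *)
Lemma pseudo_orthonormal_direct : ((v1 + v2)%MS :&: <<v3>>)%MS = 0.
Proof.
apply/eqP/rowV0P => v; rewrite sub_capmx genmxE => /andP[/sub_addsmxP[[u u']]] /=.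
rewrite [u]mx11_scalar [u']mx11_scalar !mul_scalar_mx => vE /sub_rVP[k vk].
have [_ _] := form_comb_coord (u 0 0) (u' 0 0) 0.
have [_ _] := form_comb_coord 0 0 k.
rewrite !scale0r !add0r addr0 -vE -vk => -> /eqP; rewrite eqr_opp => /eqP k0.
by rewrite vk k0 scale0r.
Qed.

Let spacelike x y : ((x *: v1 + y *: v2)%R <= v1 + v2)%MS.
Proof. by apply/sub_addsmxP; exists (x%:M, y%:M); rewrite /= !mul_scalar_mx. Qed.

Let timelike z : (z *: v3 <= <<v3>>)%MS.
Proof. by rewrite genmxE scalemx_sub. Qed.

Lemma proj_spacelike v :
  v *m proj_mx (v1 + v2)%MS <<v3>>%MS = b v v1 *: v1 + b v v2 *: v2.
Proof.
rewrite {1}[v]pseudo_orthonormal_expand -scaleNr mulmxDl.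
rewrite (proj_mx_id pseudo_orthonormal_direct (spacelike _ _)).
by rewrite (proj_mx_0 pseudo_orthonormal_direct (timelike _)) addr0.
Qed.

Lemma proj_timelike v :
  v *m proj_mx <<v3>>%MS (v1 + v2)%MS = - b v v3 *: v3.
Proof.
have direct : (<<v3>> :&: (v1 + v2)%MS)%MS = 0.
  by rewrite capmxC pseudo_orthonormal_direct.
rewrite {1}[v]pseudo_orthonormal_expand -scaleNr mulmxDl.
rewrite (proj_mx_0 direct (spacelike _ _)).
by rewrite (proj_mx_id direct (timelike _)) add0r.
Qed.

End PseudoOrthonormal.

(** * Koszul's formula *)

(** Metric compatibility makes nabla_U skew for g on pairs of fields with
    constant inner product, and zero torsion turns brackets into differences
    of covariant derivatives; the six remaining terms combine linearly. *)
Lemma koszul_constant (R : realType) (n : nat) (M : manifoldType R n)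
    (g : M -> 'rV[R]_n -> 'rV[R]_n -> R) nabla (X Y Z : M -> 'rV[R]_n)
    (xy xz yz : R) :
    (forall p u v, g p u v = g p v u) -> (forall p u, scalar (g p u)) ->
    levi_civita g nabla ->
    vector_field X -> vector_field Y -> vector_field Z ->
    on_fields g X Y = (fun _ => xy) -> on_fields g X Z = (fun _ => xz) ->
    on_fields g Y Z = (fun _ => yz) ->
  forall p, 2 * g p (nabla X Y p) (Z p) = g p (lie_bracket X Y p) (Z p)
    - g p (lie_bracket Y Z p) (X p) + g p (lie_bracket Z X p) (Y p).
Proof.
move=> gC glin [_ tor met] sX sY sZ gXY gXZ gYZ p.
have br U V : vector_field U -> vector_field V ->
    lie_bracket U V p = nabla U V p - nabla V U p.
  move=> sU sV; have := tor U V sU sV p; rewrite /torsion => /eqP.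
  by rewrite subr_eq0 => /eqP <-.
have skew U V W (c : R) : vector_field U -> vector_field V -> vector_field W ->
    on_fields g V W = (fun _ => c) ->
    g p (nabla U V p) (W p) = - g p (nabla U W p) (V p).
  move=> sU sV sW gVW; have := met U V W sU sV sW p.
  rewrite /cov_deriv gVW lie_deriv_cst /on_fields sub0r [g p (V p) _]gC.
  by move=> e; lra.
rewrite !br // !(form_subl (gC p) (glin p)).
by rewrite (skew X Y Z yz) // (skew Y X Z xz) // (skew Z X Y xy) //; lra.
Qed.

(** * The Bott connection of the frame *)

Section BottFrame.
Variables (R : realType) (M : manifoldType R 3) (alpha beta gamma delta : R).
Variables (g : M -> 'rV[R]_3 -> 'rV[R]_3 -> R) (e1 e2 e3 : M -> 'rV[R]_3).
Hypothesis glor : lorentzian_metric g.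
Hypotheses (s1 : vector_field e1) (s2 : vector_field e2) (s3 : vector_field e3).
Hypothesis ortho : pseudo_orthonormal g e1 e2 e3.
Hypothesis h12 : forall p, lie_bracket e1 e2 p =
  - alpha *: e1 p - beta *: e2 p - beta *: e3 p.
Hypothesis h13 : forall p, lie_bracket e1 e3 p =
  alpha *: e1 p + beta *: e2 p + beta *: e3 p.
Hypothesis h23 : forall p, lie_bracket e2 e3 p =
  gamma *: e1 p + delta *: e2 p + delta *: e3 p.
Variables nablaL nablaB : (M -> 'rV[R]_3) -> (M -> 'rV[R]_3) -> M -> 'rV[R]_3.
Hypothesis hL : levi_civita g nablaL.
Hypothesis hB : bott_connection (span2 e1 e2) (span1 e3) nablaL nablaB.

Local Notation C := (frame_comb e1 e2 e3).

Let sC x y z : vector_field (C x y z).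
Proof. exact: vector_field_frame_comb. Qed.

Let gC p u v : g p u v = g p v u. Proof. by case: glor. Qed.
Let glin p u : scalar (g p u). Proof. by case: glor. Qed.

Let C1 : e1 = C 1 0 0.
Proof. by apply/funext => p; rewrite /frame_comb scale1r !scale0r !addr0. Qed.
Let C2 : e2 = C 0 1 0.
Proof. by apply/funext => p; rewrite /frame_comb scale1r !scale0r add0r addr0. Qed.
Let C3 : e3 = C 0 0 1.
Proof. by apply/funext => p; rewrite /frame_comb scale1r !scale0r !add0r. Qed.

Lemma frame_comb_coord x y z p :
  [/\ g p (C x y z p) (e1 p) = x, g p (C x y z p) (e2 p) = y
    & g p (C x y z p) (e3 p) = - z].
Proof. exact: form_comb_coord. Qed.

Lemma lie_bracket_frame_comb x1 x2 x3 y1 y2 y3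
    (u12 := x1 * y2 - x2 * y1) (u13 := x1 * y3 - x3 * y1)
    (u23 := x2 * y3 - x3 * y2) :
  lie_bracket (C x1 x2 x3) (C y1 y2 y3) =
  C (- alpha * u12 + alpha * u13 + gamma * u23)
    (- beta * u12 + beta * u13 + delta * u23)
    (- beta * u12 + beta * u13 + delta * u23).
Proof.
rewrite field_bilinear_frame_comb //; last exact: lie_bracket_bilinear.
apply/funext => p; rewrite (lie_bracketC e1 e2) (lie_bracketC e1 e3).
rewrite (lie_bracketC e2 e3) h12 h13 h23.
have self X : lie_bracket X X p = 0 by rewrite /lie_bracket subrr.
by rewrite !self /frame_comb /u12 /u13 /u23; apply/rowP => i; rewrite !mxE; ring.
Qed.

Lemma metric_frame_comb x1 x2 x3 y1 y2 y3 p :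
  g p (C x1 x2 x3 p) (C y1 y2 y3 p) = x1 * y1 + x2 * y2 - x3 * y3.
Proof.
rewrite [LHS](form_comb _ _ _ (gC p) (glin p)) 3![g p _ (C _ _ _ p)]gC.
by have [-> -> ->] := frame_comb_coord y1 y2 y3 p; rewrite mulrN.
Qed.

Lemma levi_civita_frame_comb x1 x2 x3 y1 y2 y3 z1 z2 z3 p :
  2 * g p (nablaL (C x1 x2 x3) (C y1 y2 y3) p) (C z1 z2 z3 p) =
    g p (lie_bracket (C x1 x2 x3) (C y1 y2 y3) p) (C z1 z2 z3 p)
  - g p (lie_bracket (C y1 y2 y3) (C z1 z2 z3) p) (C x1 x2 x3 p)
  + g p (lie_bracket (C z1 z2 z3) (C x1 x2 x3) p) (C y1 y2 y3 p).
Proof.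
have cst u1 u2 u3 v1 v2 v3 : on_fields g (C u1 u2 u3) (C v1 v2 v3) =
    fun _ => u1 * v1 + u2 * v2 - u3 * v3.
  by apply/funext => q; exact: metric_frame_comb.
exact: (koszul_constant gC glin hL (sC _ _ _) (sC _ _ _) (sC _ _ _)
  (cst _ _ _ _ _ _) (cst _ _ _ _ _ _) (cst _ _ _ _ _ _)).
Qed.

(** On the spacelike plane the coefficients come from Koszul's formula; for
    mixed arguments they are components of the brackets; and
    nabla_e3 e3 = 0 because g(nablaL_e3 e3, e3) is half the derivative of the
    constant g(e3, e3). *)
Lemma bott_frame_comb x1 x2 x3 y1 y2 y3 :
  nablaB (C x1 x2 x3) (C y1 y2 y3) =
  C (- alpha * (x1 * y2 + x3 * y1) - beta * x2 * y2 - gamma * x3 * y2)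
    (alpha * x1 * y1 + beta * (x2 * y1 - x3 * y1) - delta * x3 * y2)
    (beta * x1 * y3 + delta * x2 * y3).
Proof.
have [conB DD D'D DD' D'D'] := hB.
rewrite field_bilinear_frame_comb //; last exact: connection_bilinear conB.
apply/funext => p.
have D1 : section_of (span2 e1 e2) e1 by split=> // q; exact: addsmxSl.
have D2 : section_of (span2 e1 e2) e2 by split=> // q; exact: addsmxSr.
have D3 : section_of (span1 e3) e3 by split=> // q; rewrite genmxE.
have projD X x y : g p (X p) (e1 p) = x -> g p (X p) (e2 p) = y ->
    Defs.proj (span2 e1 e2) (span1 e3) X p = x *: e1 p + y *: e2 p.
  by move=> <- <-; exact: (proj_spacelike (gC p) (glin p) (ortho p)).
have projD' X z : g p (X p) (e3 p) = - z ->
    Defs.proj (span1 e3) (span2 e1 e2) X p = z *: e3 p.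
  move=> Xz; rewrite -[z]opprK -Xz.
  exact: (proj_timelike (gC p) (glin p) (ortho p)).
have lc x1 x2 x3 y1 y2 y3 z1 z2 z3 :=
  levi_civita_frame_comb x1 x2 x3 y1 y2 y3 z1 z2 z3 p.
have [L111 L112] : g p (nablaL e1 e1 p) (e1 p) = 0 /\
                   g p (nablaL e1 e1 p) (e2 p) = alpha.
  split; [have := lc 1 0 0 1 0 0 1 0 0 | have := lc 1 0 0 1 0 0 0 1 0];
  by rewrite !lie_bracket_frame_comb !metric_frame_comb -?C1 -?C2; lra.
have [L121 L122] : g p (nablaL e1 e2 p) (e1 p) = - alpha /\
                   g p (nablaL e1 e2 p) (e2 p) = 0.
  split; [have := lc 1 0 0 0 1 0 1 0 0 | have := lc 1 0 0 0 1 0 0 1 0];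
  by rewrite !lie_bracket_frame_comb !metric_frame_comb -?C1 -?C2; lra.
have [L211 L212] : g p (nablaL e2 e1 p) (e1 p) = 0 /\
                   g p (nablaL e2 e1 p) (e2 p) = beta.
  split; [have := lc 0 1 0 1 0 0 1 0 0 | have := lc 0 1 0 1 0 0 0 1 0];
  by rewrite !lie_bracket_frame_comb !metric_frame_comb -?C1 -?C2; lra.
have [L221 L222] : g p (nablaL e2 e2 p) (e1 p) = - beta /\
                   g p (nablaL e2 e2 p) (e2 p) = 0.
  split; [have := lc 0 1 0 0 1 0 1 0 0 | have := lc 0 1 0 0 1 0 0 1 0];
  by rewrite !lie_bracket_frame_comb !metric_frame_comb -?C1 -?C2; lra.
have L333 : g p (nablaL e3 e3 p) (e3 p) = 0.
  have := lc 0 0 1 0 0 1 0 0 1.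
  by rewrite !lie_bracket_frame_comb !metric_frame_comb -?C3; lra.
have [b31 b32 b13 b23] : [/\ lie_bracket e3 e1 = C (- alpha) (- beta) (- beta),
   lie_bracket e3 e2 = C (- gamma) (- delta) (- delta),
   lie_bracket e1 e3 = C alpha beta beta &
   lie_bracket e2 e3 = C gamma delta delta].
  by split; apply/funext => q; rewrite ?(lie_bracketC e1 e3) ?(lie_bracketC e2 e3)
    ?h13 ?h23 /frame_comb //; apply/rowP => i; rewrite !mxE; ring.
have coord x y z := frame_comb_coord x y z p.
have B11 : nablaB e1 e1 p = 0 *: e1 p + alpha *: e2 p.
  by rewrite (DD _ _ D1 D1); exact: projD.
have B12 : nablaB e1 e2 p = - alpha *: e1 p + 0 *: e2 p.
  by rewrite (DD _ _ D1 D2); exact: projD.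
have B21 : nablaB e2 e1 p = 0 *: e1 p + beta *: e2 p.
  by rewrite (DD _ _ D2 D1); exact: projD.
have B22 : nablaB e2 e2 p = - beta *: e1 p + 0 *: e2 p.
  by rewrite (DD _ _ D2 D2); exact: projD.
have B31 : nablaB e3 e1 p = - alpha *: e1 p + - beta *: e2 p.
  rewrite (D'D _ _ D3 D1) b31.
  by apply: projD; have [] := coord (- alpha) (- beta) (- beta).
have B32 : nablaB e3 e2 p = - gamma *: e1 p + - delta *: e2 p.
  rewrite (D'D _ _ D3 D2) b32.
  by apply: projD; have [] := coord (- gamma) (- delta) (- delta).
have B13 : nablaB e1 e3 p = beta *: e3 p.
  by rewrite (DD' _ _ D1 D3) b13; apply: projD'; have [] := coord alpha beta beta.
have B23 : nablaB e2 e3 p = delta *: e3 p.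
  by rewrite (DD' _ _ D2 D3) b23; apply: projD'; have [] := coord gamma delta delta.
have B33 : nablaB e3 e3 p = 0 *: e3 p.
  by rewrite (D'D' _ _ D3 D3); apply: projD'; rewrite L333 oppr0.
rewrite B11 B12 B13 B21 B22 B23 B31 B32 B33 /frame_comb.
by apply/rowP => i; rewrite !mxE; ring.
Qed.

(** Since the connection and the bracket send constant combinations of the
    frame to such combinations, all terms of the curvature are constant
    combinations, and the Ricci form is a polynomial in the coefficients. *)
Lemma sym_ricci_frame_comb x1 x2 x3 y1 y2 y3 p :
  sym_ricci g e1 e2 e3 nablaB (C x1 x2 x3) (C y1 y2 y3) p =
  - alpha ^+ 2 * (x1 * y1) + 2^-1 * beta * (delta - alpha) * (x1 * y2 + x2 * y1)
  + beta * (alpha + delta) * (x1 * y3 + x3 * y1)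
  - (alpha ^+ 2 + beta ^+ 2 + beta * gamma) * (x2 * y2)
  + (2^-1 * (alpha * delta + beta * gamma) + delta ^+ 2) * (x2 * y3 + x3 * y2).
Proof.
(* The frame fields are expressed as combinations, so that the formulas for
   combinations apply to every term. *)
have curv1 a1 a2 a3 b1 b2 b3 : curvature nablaB (C a1 a2 a3) e1 (C b1 b2 b3) =
    curvature nablaB (C a1 a2 a3) (C 1 0 0) (C b1 b2 b3) by rewrite -C1.
have curv2 a1 a2 a3 b1 b2 b3 : curvature nablaB (C a1 a2 a3) e2 (C b1 b2 b3) =
    curvature nablaB (C a1 a2 a3) (C 0 1 0) (C b1 b2 b3) by rewrite -C2.
have curv3 a1 a2 a3 b1 b2 b3 : curvature nablaB (C a1 a2 a3) e3 (C b1 b2 b3) =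
    curvature nablaB (C a1 a2 a3) (C 0 0 1) (C b1 b2 b3) by rewrite -C3.
rewrite /sym_ricci /ricci !curv1 !curv2 !curv3 /curvature.
rewrite !bott_frame_comb !lie_bracket_frame_comb !bott_frame_comb.
rewrite !(form_subl (gC p) (glin p)).
have g1 x y z : g p (C x y z p) (e1 p) = x by case: (frame_comb_coord x y z p).
have g2 x y z : g p (C x y z p) (e2 p) = y by case: (frame_comb_coord x y z p).
have g3 x y z : g p (C x y z p) (e3 p) = - z by case: (frame_comb_coord x y z p).
rewrite !g1 !g2 !g3.
by field.
Qed.

Lemma torsion_frame_comb x1 x2 x3 y1 y2 y3 :
  torsion nablaB (C x1 x2 x3) (C y1 y2 y3) = C 0 0 (beta * (x1 * y2 - x2 * y1)).
Proof.
apply/funext => p; rewrite /torsion !bott_frame_comb lie_bracket_frame_comb.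
by rewrite /frame_comb; apply/rowP => i; rewrite !mxE; ring.
Qed.

(** The point p only serves to evaluate functions which are constant. *)
Lemma bott_not_quasi_statistical (p : M) : alpha + delta != 0 ->
  ~ quasi_statistical nablaB (sym_ricci g e1 e2 e3 nablaB).
Proof.
move=> ad0 qs.
have Q x1 x2 x3 y1 y2 y3 z1 z2 z3 :=
  qs _ _ _ (sC x1 x2 x3) (sC y1 y2 y3) (sC z1 z2 z3) p.
have lie0 X x1 x2 x3 y1 y2 y3 :
    lie_deriv X (sym_ricci g e1 e2 e3 nablaB (C x1 x2 x3) (C y1 y2 y3)) p = 0.
  have /funext -> := sym_ricci_frame_comb x1 x2 x3 y1 y2 y3.
  exact: lie_deriv_cst.
have beta0 : beta = 0.
  have := Q 1 0 0 0 1 0 0 0 1.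
  rewrite /cov_deriv !lie0 !bott_frame_comb torsion_frame_comb.
  rewrite !sym_ricci_frame_comb => e.
  have : beta * (alpha + delta) ^+ 2 = 0 by rewrite -e; field.
  by move/eqP; rewrite mulf_eq0 sqrf_eq0 (negPf ad0) orbF => /eqP.
have e131 : alpha * (2 * alpha ^+ 2 - 2^-1 * alpha * delta - delta ^+ 2) = 0.
  have := Q 1 0 0 0 0 1 1 0 0.
  rewrite /cov_deriv !lie0 !bott_frame_comb torsion_frame_comb.
  by rewrite !sym_ricci_frame_comb beta0 => e; rewrite -e; field.
have e233 : delta ^+ 2 * (alpha + 2 * delta) = 0.
  have := Q 0 1 0 0 0 1 0 0 1.
  rewrite /cov_deriv !lie0 !bott_frame_comb torsion_frame_comb.
  rewrite !sym_ricci_frame_comb beta0 => e.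
  (* The equation of the triple (e2, e3, e3) is - 1/2 times the claimed one. *)
  by rewrite -[RHS](mulr0 (-2)) -e; field.
have delta0 : delta = 0.
  move/eqP: e233; rewrite mulf_eq0 sqrf_eq0 => /orP[/eqP//|/eqP ad].
  have {}ad : alpha = - 2 * delta by lra.
  have : - 16 * delta ^+ 3 = 0 by rewrite -e131 ad; field.
  by move/eqP; rewrite mulf_eq0 expf_eq0 oppr_eq0 pnatr_eq0 => /eqP.
have : 2 * alpha ^+ 3 = 0 by rewrite -e131 delta0; ring.
move/eqP; rewrite mulf_eq0 expf_eq0 pnatr_eq0 /= => /eqP alpha0.
by rewrite alpha0 delta0 addr0 eqxx in ad0.
Qed.

End BottFrame.

(** * The Lie group *)

Unset Implicit Arguments.

Theorem theorem3p8 (R : realType) (alpha beta gamma delta : R)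
    (halphadelta : alpha + delta != 0) (halphagamma : alpha * gamma = 0)
    (G7 : lieGroupType R 3)
    (hconnected : connected [set: G7]) (hsimply : simply_connected R G7)
    (g : G7 -> 'rV[R]_3 -> 'rV[R]_3 -> R)
    (hlorentz : lorentzian_metric g) (hleft : left_invariant_metric g)
    (e1 e2 e3 : G7 -> 'rV[R]_3)
    (hbasis : lie_algebra_basis e1 e2 e3)
    (horthonormal : pseudo_orthonormal g e1 e2 e3)
    (h12 : forall p, lie_bracket e1 e2 p =
       - alpha *: e1 p - beta *: e2 p - beta *: e3 p)
    (h13 : forall p, lie_bracket e1 e3 p =
       alpha *: e1 p + beta *: e2 p + beta *: e3 p)
    (h23 : forall p, lie_bracket e2 e3 p =
       gamma *: e1 p + delta *: e2 p + delta *: e3 p)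
    (nablaL nablaB :
       (G7 -> 'rV[R]_3) -> (G7 -> 'rV[R]_3) -> G7 -> 'rV[R]_3)
    (hnablaL : levi_civita g nablaL)
    (hnablaB : bott_connection (span2 e1 e2) (span1 e3) nablaL nablaB) :
  ~ quasi_statistical nablaB (sym_ricci g e1 e2 e3 nablaB).
Proof.
have [[s1 _] [s2 _] [s3 _] _] := hbasis.
exact: (bott_not_quasi_statistical hlorentz s1 s2 s3 horthonormal h12 h13 h23
          hnablaL hnablaB (1%g : G7) halphadelta).
Qed.
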